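(* Let $G$ be an infinite discrete countable group and let $(X,G)$ be a minimal $G$-system. Let $(H,G)$ be the maximal equicontinuous factor of $(X,G)$ with factor map $\pi:X\to H$ and let $\nu$ be the Haar measure on $H$. Let $K_1\in\mathbb{N}\cup\{\infty\}$ and $K_2\in\mathbb{N}$ be such that (1) $\nu(\{y\in H:|\pi^{-1}(y)|=K_1\})=1$; and (2) $\pi$ is almost $K_2$ to one. If $\lceil K_1/K_2\rceil\ge 2$, then for every $K\in\mathbb{N}$ with $2\le K\le \lceil K_1/K_2\rceil$, $(X,G)$ has a non-trivial $K$-IT-tuple, i.e. $\mathrm{IT}_K(X,G)\setminus\triangle^{(K)}(X)\neq\emptyset$.
   Context: A $G$-system is a compact metric space $X$ with a $G$-action by homeomorphisms; minimal means every orbit is dense. The maximal equicontinuous factor $(H,G)$ is $X/S_{eq}$ where $S_{eq}$ is the smallest closed $G$-invariant equivalence relation with equicontinuous quotient; $\pi$ is the quotient map; $\nu$ is the unique $G$-invariant Borel probability measure on $H$ (Haar measure). $\pi$ is almost $K_2$ to one if $\{h\in H:|\pi^{-1}(h)|=K_2\}$ is residual in $H$. For a tuple $(A_1,\dots,A_k)$ of subsets of $X$, a set $J\subset G$ is an independence set if for every nonempty finite $I\subset J$ and every $\sigma:I\to\{1,\dots,k\}$, $\bigcap_{s\in I}s^{-1}A_{\sigma(s)}\neq\emptyset$. A tuple $(x_1,\dots,x_n)\in X^n$ is an IT-tuple of length $n$ if for every product neighborhood $U_1\times\cdots\times U_n$ of it, $(U_1,\dots,U_n)$ has an infinite independence set;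 $\mathrm{IT}_n(X,G)$ denotes the set of these. $\triangle^{(n)}(X)=\{(x_1,\dots,x_n)\in X^n: x_i=x_j\text{ for some }i\neq j\}$. $\lceil\infty/K_2\rceil=\infty$. *)

(* Defs.v *)
From HB Require Import structures.
From mathcomp Require Import all_boot all_order all_algebra.
From mathcomp Require Import all_classical all_reals all_analysis.
Set Implicit Arguments. Unset Strict Implicit. Unset Printing Implicit Defensive.
Import Order.TTheory GRing.Theory Num.Theory.
Local Open Scope classical_set_scope.
Local Open Scope ring_scope.

Record group := Group {
  gcar :> Type;
  gmul : gcar -> gcar -> gcar;
  gone : gcar;
  ginv : gcar -> gcar;
  gmulA : forall a b c, gmul a (gmul b c) = gmul (gmul a b) c;
  gmul1 : forall a, gmul gone a = a;
  gmulV : forall a, gmul (ginv a) a = gone }.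

(* act : G -> X -> X is an action of G on X by homeomorphisms
   (continuity of each act g plus the action laws; act (g^-1) is the
   continuous inverse of act g). *)
Definition is_action (G : group) (X : topologicalType) (act : G -> X -> X) :=
  [/\ forall g, continuous (act g),
      forall x, act (gone G) x = x &
      forall g h x, act (gmul g h) x = act g (act h x)].

Definition Gsystem (R : realType) (G : group) (X : pseudoMetricType R)
  (act : G -> X -> X) :=
  [/\ compact [set: X], hausdorff_space X & is_action act].

Definition minimal_sys (G : group) (X : topologicalType) (act : G -> X -> X) :=
  forall x : X, closure [set act g x | g in [set: G]] = [set: X].

Definition factor_map (G : group) (X Y : topologicalType)
  (actX : G -> X -> X) (actY : G -> Y -> Y) (p : X -> Y) :=
  [/\ continuous p, forall y, exists x, p x = y &
      forall g x, p (actX g x) = actY g (p x)].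

Definition equicontinuous_sys (R : realType) (G : group) (Y : pseudoMetricType R)
  (act : G -> Y -> Y) :=
  forall e : R, 0 < e -> exists2 d : R, 0 < d &
    forall y z : Y, ball y d z -> forall g, ball (act g y) e (act g z).

(* (H,G) with p : X -> H is the maximal equicontinuous factor of (X,G):
   p is a factor map onto an equicontinuous compact metric G-system whose
   fibre relation {(x,x') | p x = p x'} is contained in the fibre relation
   of every factor map onto an equicontinuous compact metric G-system,
   i.e. it is the smallest closed invariant equivalence relation S_eq
   with equicontinuous quotient. *)
Definition is_MEF (R : realType) (G : group) (X H : pseudoMetricType R)
  (actX : G -> X -> X) (actH : G -> H -> H) (p : X -> H) :=
  [/\ Gsystem actH, factor_map actX actH p, equicontinuous_sys actH &
      forall (Y : pseudoMetricType R) (actY : G -> Y -> Y) (f : X -> Y),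
        Gsystem actY -> factor_map actX actY f -> equicontinuous_sys actY ->
        forall x x', p x = p x' -> f x = f x'].

Inductive natinf := Fin of nat | Inf.

Definition card_is {T} (A : set T) (K : natinf) : Prop :=
  match K with Fin n => (A #= `I_n)%card | Inf => infinite_set A end.

Notation borel_type T := (g_sigma_algebraType (@open T)) (only parsing).

Definition residual (T : topologicalType) (A : set T) :=
  exists U : nat -> set T, (forall n, open (U n) /\ dense (U n)) /\
    \bigcap_n U n `<=` A.

Definition almost_to_one (X H : topologicalType) (p : X -> H) (K : nat) :=
  residual [set h : H | card_is (p @^-1` [set h]) (Fin K)].

Definition indep_set (G : group) (X : Type) (act : G -> X -> X) (k : nat)
  (A : 'I_k -> set X) (J : set G) :=
  forall (I : set G) (s : G -> 'I_k), finite_set I -> I !=set0 -> I `<=` J ->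
    exists x : X, forall g, I g -> A (s g) (act g x).

Definition IT_tuple (G : group) (X : topologicalType) (act : G -> X -> X)
  (n : nat) (x : 'I_n -> X) :=
  forall U : 'I_n -> set X, (forall i, nbhs (x i) (U i)) ->
    exists J : set G, infinite_set J /\ indep_set act U J.

Definition in_diag (X : Type) (n : nat) (x : 'I_n -> X) :=
  exists i j : 'I_n, i != j /\ x i = x j.

Definition le_ceil_div (K : nat) (K1 : natinf) (K2 : nat) : Prop :=
  match K1 with Fin n => (K <= (n + K2 - 1) %/ K2)%N | Inf => True end.

(* Main.v *)
(* Put m = (K - 1) K2 + 1, so that almost every fibre has at least m points.
   As p is semi-open, for some well separated open sets U_1, ..., U_m the
   closed set C, the intersection of the closures of the interiors V_i of the
   p(U_i), has positive measure. By equicontinuity, averages over suitable finite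
   families in G make continuous functions on H nearly constant; hence a finite
   subset of H that is moved into C by a positive proportion of G keeps this
   property under small perturbations. Inductively, this gives g_0, g_1, ... in
   G such that for every word s some h satisfies g_j h in V_(s j) for j < n.
   These h form an open set, which contains an h with a fibre of K2 points; so,
   by compactness, for every infinite word s there are K2 points of X, one of
   which lies in g_j^-1 (cl U_(s j)) for each j.
   By Galvin's partition theorem, either the cyclic word on some K separated
   small balls is realized along every increasing sequence of times in an
   infinite set, which yields an infinite independence set, or along some
   infinite set of times no point visits K separated small balls infinitely
   often. In the second case K2 points visit infinitely often at most
   (K - 1) K2 < m of the cl U_i, a contradiction. Letting the radius of the
   balls tend to 0 gives the IT-tuple. *)
Require Import Defs.
From HB Require Import structures.
From mathcomp Require Import all_boot all_order all_algebra.
From mathcomp Require Import all_classical all_reals all_analysis.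
From mathcomp Require Import measurable_realfun zify ring lra.
Import Order.TTheory GRing.Theory Num.Theory.
Import numFieldNormedType.Exports.
Local Open Scope classical_set_scope.
Local Open Scope ring_scope.
Set Implicit Arguments.
Unset Strict Implicit.
Unset Printing Implicit Defensive.

(** * Compactness *)

Lemma finite_net (R : realType) (X : pseudoMetricType R) (e : R) :
  compact [set: X] -> 0 < e -> exists s : seq X, forall x, exists2 y, y \in s & ball y e x.
Proof.
move=> cX e0; have [[x0 _]|X0] := pselect ([set: X] !=set0); last first.
  by exists [::] => x; exfalso; apply: X0; exists x.
pose T := HB.pack_for ptopologicalType X (isPointed.Build X x0).
have cT : @compact T [set: T] by [].
rewrite compact_cover in cT.
have [||D' _ cov] := cT X [set: X] (fun x => (ball x e)°).
- by move=> x _; exact: open_interior.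
- by move=> x _; exists x => //; exact: nbhsx_ballx.
exists (finmap.enum_fset D') => x; have [y yD yx] := cov x I.
by exists y => //; exact: interior_subset yx.
Qed.

(** Near-covering compactness, applied with the filter of positive radii tending to 0, turns the
    local radii into a uniform one. *)
Lemma compact_unif_continuous (R : realType) (X Y : pseudoMetricType R)
    (f : X -> Y) (e : R) : compact [set: X] -> continuous f -> 0 < e ->
  exists2 d : R, 0 < d & forall x y, ball x d y -> ball (f x) e (f y).
Proof.
move=> /compact_near_coveringP cX cf e0.
have := cX _ (0:R)^'+ (fun d x => forall y, ball x d y -> ball (f x) e (f y)).
case.
  move=> x _; have e2 : 0 < e / 2 by lra.
  have /nbhs_ballP[r /= r0 fr] := cf x _ (nbhsx_ballx (f x) (e / 2) e2).
  have r2 : 0 < r / 2 by lra.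
  exists (ball x (r / 2), [set d | d < r / 2]) => /=.
    split; first exact: nbhsx_ballx.
    exact: nbhs_right_lt.
  move=> [z d] /= [xz dr] y zy.
  rewrite (splitr e); apply: (@ball_triangle _ _ (f x)).
    by apply/ball_sym/fr; apply: le_ball xz; lra.
  apply: fr; rewrite (splitr r); apply: ball_triangle xz _.
  by apply: le_ball zy; lra.
move=> d /= d0 dP; exists (d / 2); first by lra.
move=> x y xy; apply: (dP (d / 2)) => //=; last by lra.
by rewrite /ball /= sub0r normrN gtr0_norm; lra.
Qed.

Lemma closed_borel (H : ptopologicalType) (D : set H) :
  closed D -> measurable (D : set (borel_type H)).
Proof.
move=> cD; rewrite -[D]setCK; apply: measurableC.
by apply: sub_sigma_algebra; exact: closed_openC.
Qed.

(** Limits along an ultrafilter replace convergent subsequences: one filter serves all coordinates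
    at once. *)
Lemma ultra_cvg (T : topologicalType) (I : Type) (F : set_system I) (x : I -> T) :
  compact [set: T] -> UltraFilter F -> exists l : T, x @ F --> l.
Proof.
move=> cT FU.
have UF : UltraFilter (x @ F).
  split; first by apply: fmap_proper_filter; exact: (@ultra_proper _ _ FU).
  move=> G GP xFG; apply/seteqP; split => // A GA.
  have [//|FC] := in_ultra_setVsetC (x @^-1` A) FU.
  exfalso; apply: (@filter_not_empty _ _ GP); rewrite -(setICr A).
  by apply: filterI => //; exact: (xFG (~` A)).
rewrite compact_ultra in cT.
by have [l [_ xl]] := cT _ UF filterT; exists l.
Qed.

Lemma ultra_exists (I : Type) (T : finType) (F : set_system I) (P : I -> T -> Prop) :
  UltraFilter F -> (\forall i \near F, exists t, P i t) ->
  exists t, \forall i \near F, P i t.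
Proof.
move=> FU h; have FP := @ultra_proper _ _ FU.
apply: contrapT => /forallNP nP.
have FC : \forall i \near F, forall t, ~ P i t.
  apply: filter_forall => t.
  by have [/nP//|] := in_ultra_setVsetC [set i | P i t] FU.
by have [i [[t Pt] /(_ t)]] := filter_ex (filterI h FC).
Qed.

(** Ultralimits of the tuples for [e] = 1/(n+1) are taken. Each product neighbourhood of the limit
    contains the small balls of some tuple, and the fixed separation [r] keeps the limit points
    apart. *)
Lemma IT_tuple_of_separated (R : realType) (G : group) (X : pseudoMetricType R)
    (act : G -> X -> X) (k : nat) (r : R) :
  compact [set: X] -> 0 < r ->
  (forall e : R, 0 < e -> exists x : 'I_k -> X,
     (forall i j, i != j -> ~ ball (x i) r (x j)) /\
     exists J : set G, infinite_set J /\ indep_set act (fun i => ball (x i) e) J) ->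
  exists x : 'I_k -> X, IT_tuple act x /\ ~ in_diag x.
Proof.
move=> cX r0 h.
have /choice[x xP] : forall n : nat, exists x : 'I_k -> X,
     (forall i j, i != j -> ~ ball (x i) r (x j)) /\
     exists J : set G, infinite_set J /\ indep_set act (fun i => ball (x i) n.+1%:R^-1) J.
  by move=> n; apply: h; rewrite invr_gt0 ltr0n.
have [F [FU oF]] := @ultraFilterLemma _ (\oo : set_system nat) _.
have FP := @ultra_proper _ _ FU.
have /choice[l lP] : forall i, exists l : X, (fun n => x n i) @ F --> l.
  by move=> i; exact: ultra_cvg.
exists l; split.
  move=> U Ul.
  have /choice[e eP] : forall i, exists e : R, 0 < e /\ ball (l i) e `<=` U i.
    by move=> i; have /nbhs_ballP[e /= e0 eU] := Ul i; exists e.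
  have Fn : F [set n | forall i, ball (l i) (e i / 2) (x n i) /\ n.+1%:R^-1 < e i / 2].
    apply: filter_forall => i; have [e0 _] := eP i; have e2 : 0 < e i / 2 by lra.
    apply: filterI; first by apply: (lP i); exact: nbhsx_ballx.
    apply: oF; exact: near_infty_natSinv_lt (PosNum e2).
  have [n /= nP] := filter_ex Fn.
  have [_ [J [Jinf Jind]]] := xP n; exists J; split => //.
  move=> I s fI I0 IJ; have [z zP] := Jind I s fI I0 IJ; exists z => g Ig.
  have [h1 h2] := nP (s g); have [_] := eP (s g); apply.
  rewrite (splitr (e (s g))); apply: ball_triangle h1 _.
  apply: le_ball (zP g Ig); exact: ltW.
move=> [i [j [ij lij]]].
have r2 : 0 < r / 2 by lra.
have [n /= [h1 h2]] : exists n, ball (l i) (r / 2) (x n i) /\ ball (l j) (r / 2) (x n j).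
  apply: (@filter_ex _ F); apply: filterI.
    by apply: (lP i); exact: nbhsx_ballx.
  by apply: (lP j); exact: nbhsx_ballx.
have [/(_ _ _ ij) nb _] := xP n; apply: nb; rewrite (splitr r).
by apply: ball_triangle (ball_sym h1) _; rewrite lij.
Qed.

(** * Galvin's partition theorem *)

Definition cofinal (A : set nat) := forall n, exists2 k, A k & (n < k)%N.

Definition incr (u : nat -> nat) := {homo u : i j / (i < j)%N}.

Lemma cofinal_tail (A : set nat) (s : seq nat) :
  cofinal A -> cofinal [set x | A x /\ all (ltn^~ x) s].
Proof.
move=> cA n; have [k Ak nk] := cA (n + \max_(i <- s) i)%N.
exists k; last by lia.
split => //; apply/allP => x xs /=.
by have /= := @leq_bigmax_seq _ s xpredT (fun i => i) x xs isT; lia.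
Qed.

Lemma cofinal_enum (A : nat -> set nat) :
  (forall q, cofinal (A q)) -> exists u, incr u /\ forall q, A q (u q).
Proof.
move=> cA; have [k Ak _] := cA 0%N 0%N.
pose R (a b : nat * nat) := [/\ b.1 = a.1.+1, A b.1 b.2 & (a.2 < b.2)%N].
have [|f [f0 fR]] := @dependent_choice _ R _ (0%N, k).
  by move=> [q a]; apply: cid; have [b Ab ab] := cA q.+1 a; exists (q.+1, b).
have f1 q : (f q).1 = q by elim: q => [|q IH]; [rewrite f0|case: (fR q) => -> _ _; rewrite IH].
exists (fun q => (f q).2); split.
  apply: homo_ltn => [|i]; first exact: ltn_trans.
  by case: (fR i).
by case=> [|q]; [rewrite f0|case: (fR q) => _ + _; rewrite f1].
Qed.

Lemma cofinal_exists (T : finType) (P : nat -> T -> Prop) :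
  cofinal [set n | exists t, P n t] -> exists t, cofinal (P ^~ t).
Proof.
move=> cP; apply: contrapT => /forallNP nP.
have /choice[b bP] : forall t, exists n, forall k, P k t -> (k <= n)%N.
  move=> t; have /existsNP[n nn] := nP t; exists n => k Pk.
  by rewrite leqNgt; apply/negP => nk; apply: nn; exists k.
have [k [t Pk]] := cP (\max_t b t)%N.
by rewrite ltnNge (leq_trans (bP _ _ Pk)) // leq_bigmax.
Qed.

Lemma sorted_rcons_ltn (s : seq nat) x :
  sorted ltn (rcons s x) = all (ltn^~ x) s && sorted ltn s.
Proof. by rewrite !(sorted_pairwise ltn_trans) pairwise_rcons. Qed.

(** Finite sets of naturals are represented by increasing lists; listing the subsets of {0, ...,
    n-1} keeps each diagonal step finite. *)
Fixpoint incr_seqs (n : nat) : seq (seq nat) :=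
  if n is n'.+1 then incr_seqs n' ++ [seq rcons s n' | s <- incr_seqs n']
  else [:: [::]].

Lemma mem_incr_seqs n (s : seq nat) :
  sorted ltn s -> all (ltn^~ n) s -> s \in incr_seqs n.
Proof.
elim: n s => [|n IH] s; first by case: s.
case/lastP: s => [|s x] ss sn.
  by rewrite /= mem_cat IH.
move: ss; rewrite sorted_rcons_ltn => /andP[sx ss].
move: sn; rewrite all_rcons /= ltnS leq_eqVlt => /andP[/orP[/eqP xn|xn] sn].
  rewrite /= mem_cat; apply/orP; right; rewrite xn.
  by apply/map_f/IH => //; rewrite -xn.
rewrite /= mem_cat (IH (rcons s x)) ?sorted_rcons_ltn ?sx ?ss // all_rcons /= xn /=.
by apply: sub_all sx => y /=; lia.
Qed.

(** Fusion: a_0 < a_1 < ... are chosen from decreasing sets, the set kept after a_i meeting the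
    requirement of every increasing list with entries at most a_i. By the first hypothesis only the
    elements beyond a list matter for it. *)
Lemma diagonal_cofinal (D : seq nat -> set nat -> Prop) (M : set nat) :
  (forall s N N', D s N ->
    (forall x, N' x -> all (ltn^~ x) s -> N x) -> D s N') ->
  (forall s N, cofinal N -> N `<=` M ->
    exists N', [/\ N' `<=` N, cofinal N' & D s N']) ->
  cofinal M ->
  exists N, [/\ N `<=` M, cofinal N &
    forall s, sorted ltn s -> (forall x, x \in s -> N x) -> D s N].
Proof.
move=> Dher Dex cM.
have DexL (L : seq (seq nat)) N : cofinal N -> N `<=` M ->
    exists N', [/\ N' `<=` N, cofinal N' & forall s, s \in L -> D s N'].
  elim: L N => [|s L IH] N cN NM; first by exists N; split => // s.
  have [N1 [N1N cN1 D1]] := Dex s N cN NM.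
  have [N2 [N2N cN2 D2]] := IH N1 cN1 (subset_trans N1N NM).
  exists N2; split => //; first exact: subset_trans N2N N1N.
  move=> t; rewrite inE => /predU1P[->|/D2//].
  by apply: Dher D1 _ => x /N2N.
have [N0 [N0M cN0 D0]] := Dex [::] M cM (@subset_refl _ M).
pose good (N : set nat) := cofinal N /\ N `<=` M.
(* The premise [good a.2] makes the relation total, as dependent choice requires. *)
pose R (a b : nat * set nat) := good a.2 ->
  [/\ a.2 b.1, good b.2, b.2 `<=` [set x | a.2 x /\ (b.1 < x)%N] &
     forall s, s \in incr_seqs b.1.+1 -> D s b.2].
have [|f [f0 fR]] := @dependent_choice _ R _ (0%N, N0).
  move=> [a N]; apply: cid; have [gN|ngN] := pselect (good N); last by exists (a, N).
  have [cN NM] := gN; have [k Nk _] := cN 0%N.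
  have [||N' [N'N cN' DN']] := DexL (incr_seqs k.+1) [set x | N x /\ (k < x)%N].
  - by move=> n; have [j Nj nj] := cN (maxn n k); exists j => /=; [split => //|]; lia.
  - by move=> x [/NM].
  by exists (k, N') => _; split => //; split => // x /N'N[/NM].
have gf i : good (f i).2.
  by elim: i => [|i IH]; [rewrite f0|case: (fR i IH)].
pose a i := (f i.+1).1.
have anti i j : (i <= j)%N -> (f j).2 `<=` (f i).2.
  move=> ij; rewrite -(subnK ij); elim: (j - i)%N => [|k IH] //.
  apply: subset_trans IH; rewrite addSn => x.
  by have [_ _ h _] := fR (k + i)%N (gf _) => /h[].
have aP i : (f i).2 (a i) by case: (fR i (gf _)).
have af i j : (i <= j)%N -> (f i).2 (a j) by move=> /anti; apply; exact: aP.
have ainc : incr a.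
  apply: homo_ltn => [|i]; first exact: ltn_trans.
  by have [_ _ h _] := fR i (gf _); have /h[] := aP i.+1.
have aleq i j : (a i < a j)%N -> (i < j)%N.
  by have [//|/ainc|->] := ltngtP i j; lia.
exists (range a); split.
- by move=> _ [i _ <-]; apply: (gf i).2; exact: aP.
- move=> n; exists (a n.+1); first by exists n.+1.
  suff: (n <= a n)%N by have := ainc n n.+1 (ltnSn n); lia.
  by elim: n => // n IH; have := ainc n n.+1 (ltnSn n); lia.
case/lastP => [|s x] ss sa.
  by apply: Dher D0 _ => x [i _ <-] _; have := af 0%N i; rewrite f0; apply.
have [i _ aix] : range a x by apply: sa; rewrite mem_rcons mem_head.
have [_ _ _ /(_ (rcons s x)) Di] := fR i (gf i).
apply: Dher (Di _) _.
  apply: mem_incr_seqs => //; rewrite -/(a i) aix all_rcons /= ltnSn /=.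
  move: ss; rewrite sorted_rcons_ltn => /andP[/allP h _].
  by apply/allP => y /h /=; lia.
(* The list ends with [a i], so terms beyond it have index above [i] and lie in [(f i.+1).2]. *)
move=> _ [j _ <-]; rewrite all_rcons /= -aix => /andP[/aleq ij _].
exact: af.
Qed.

Section galvin.
Variable F : seq nat -> Prop.

Let accepts (M : set nat) (s : seq nat) := forall u, incr u ->
  (forall i, M (u i)) -> all (ltn^~ (u 0%N)) s -> exists n, F (s ++ mkseq u n).

Let rejects (M : set nat) (s : seq nat) :=
  forall N, N `<=` M -> cofinal N -> ~ accepts N s.

Let incr_ge (u : nat -> nat) s i : incr u -> all (ltn^~ (u 0%N)) s ->
  all (ltn^~ (u i)) s.
Proof.
move=> ui /allP h; apply/allP => x /h /=.
by case: i => // i; have := ui 0%N i.+1 (ltn0Sn _); lia.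
Qed.

Let acceptsW M N s : accepts M s ->
  (forall x, N x -> all (ltn^~ x) s -> M x) -> accepts N s.
Proof.
move=> aM NM u ui uN us; apply: aM => // i.
by apply: NM => //; exact: incr_ge.
Qed.

Let rejectsW M N s : rejects M s ->
  (forall x, N x -> all (ltn^~ x) s -> M x) -> rejects N s.
Proof.
move=> rM NM N' N'N cN' aN'.
apply: (rM [set x | N' x /\ all (ltn^~ x) s]).
- by move=> x [/N'N + h]; move/NM; exact.
- exact: cofinal_tail.
- by apply: acceptsW aN' _ => x [].
Qed.

(** Combinatorial forcing: a first diagonalization gives [N] that accepts or rejects each of its
    finite lists. If the empty list is rejected, a second one gives a subset along which rejection
    passes from [s] to [rcons s n]; so all its lists are rejected and none is in [F]. *)
Theorem galvin M : cofinal M -> exists N, [/\ N `<=` M, cofinal N &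
  (forall s, sorted ltn s -> (forall x, x \in s -> N x) -> ~ F s) \/
  (forall u, incr u -> (forall i, N (u i)) -> exists n, F (mkseq u n))].
Proof.
move=> cM.
have [||N [NM cN decN]] :=
    @diagonal_cofinal (fun s N => accepts N s \/ rejects N s) M _ _ cM.
- by move=> s N N' [h|h] NN'; [left; exact: acceptsW h NN'|right; exact: rejectsW h NN'].
- move=> s N cN NM.
  have [[N' [N'N cN' aN']]|no] := pselect (exists N', [/\ N' `<=` N, cofinal N' & accepts N' s]).
    by exists N'; split => //; left.
  by exists N; split => //; right => N' N'N cN' aN'; apply: no; exists N'.
have [aN|rN] := decN [::] isT ltac:(by []).
  by exists N; split => //; right => u ui uN; exact: aN.
pose D s (N' : set nat) := sorted ltn s -> (forall x, x \in s -> N x) ->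
  rejects N s -> forall n, N' n -> all (ltn^~ n) s -> rejects N (rcons s n).
have [||P [PN cP DP]] := @diagonal_cofinal D N _ _ cN.
- move=> s N1 N2 D1 N21 ss sN rs n N2n sn; exact: D1 (N21 _ N2n sn) sn.
- move=> s N1 cN1 N1N.
  have [cN2|] := pselect (cofinal [set n | N1 n /\ rejects N (rcons s n)]).
    exists [set n | N1 n /\ rejects N (rcons s n)]; split => //; first by move=> x [].
    by move=> ss sN rs n [].
  (* Otherwise all extensions of [s] by elements of [N1] beyond [n0] are accepted, being decided;
     then this tail accepts [s], contrary to its rejection. *)
  move=> /existsNP[n0 n0P].
  have cN2 : cofinal [set x | N1 x /\ all (ltn^~ x) (n0 :: s)] by exact: cofinal_tail.
  exists [set x | N1 x /\ all (ltn^~ x) (n0 :: s)]; split => //; first by move=> x [].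
  move=> ss sN rs; exfalso; apply: rs cN2 _; first by move=> x [/N1N].
  move=> u ui uN us.
  have [N1u0 /= /andP[n0u0 su0]] := uN 0%N.
  have [||acc|rej] := decN (rcons s (u 0%N)).
  + by rewrite sorted_rcons_ltn su0.
  + by move=> x; rewrite mem_rcons inE => /predU1P[->|/sN //]; exact: N1N.
  + have [|||k Fk] := acc (u \o S).
    * by move=> i j ij; exact: ui.
    * by move=> i; apply: N1N; case: (uN i.+1).
    * rewrite all_rcons /=; apply/andP; split; first exact: ui.
      exact: incr_ge.
    exists k.+1; move: Fk; rewrite cat_rcons /mkseq /= -[1%N]addn0 iotaDl.
    by rewrite -map_comp.
  + by exfalso; apply: n0P; exists (u 0%N).
exists P; split => //; first exact: subset_trans PN NM.
left => s ss sP Fs.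
have : rejects N s.
  elim/last_ind: s ss sP {Fs} => [//|s x IH] ss sP.
  move: ss; rewrite sorted_rcons_ltn => /andP[sx ss].
  apply: DP => //.
  - by move=> y ys; apply: sP; rewrite mem_rcons inE ys orbT.
  - by move=> y ys; apply/PN/sP; rewrite mem_rcons inE ys orbT.
  - by apply: IH => // y ys; apply: sP; rewrite mem_rcons inE ys orbT.
  - by apply: sP; rewrite mem_rcons mem_head.
(* A list in [F] is accepted by means of the empty prefix. *)
move=> /(_ N (@subset_refl _ _) cN); apply => u _ _ _.
by exists 0%N; rewrite cats0.
Qed.

End galvin.

(** * Independence from cyclic visits *)

Lemma finite_set_nat_bounded (A : set nat) :
  finite_set A -> exists n, forall k, A k -> (k < n)%N.
Proof.
move=> /finite_fsetP[X ->]; exists (\max_(i <- finmap.enum_fset X) i).+1 => k /= kX.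
by rewrite ltnS; exact: (@leq_bigmax_seq _ _ xpredT (fun i => i) k kX isT).
Qed.

(* From each block of 2K consecutive terms of u, K consecutive ones are kept,
   placed so that the term of offset K comes at position t (q %/ K) of its
   cycle: along the cyclic word 0, 1, ..., K - 1, 0, 1, ... it receives the
   prescribed letter. *)
Definition block_word (u : nat -> nat) (K : nat) (t : nat -> nat) (q : nat) : nat :=
  u ((q %/ K) * (2 * K) + (K - t (q %/ K)%N) + q %% K)%N.

(** Kept offsets in a block lie between 1 and 2K - 1, so passing to the next block always
    advances. *)
Lemma block_word_incr u K t : incr u -> (forall q, t q < K)%N ->
  incr (block_word u K t).
Proof.
move=> ui tK; apply: homo_ltn => [|q]; first exact: ltn_trans.
have K0 : (0 < K)%N by apply: leq_ltn_trans (tK 0%N).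
apply: ui; have bK := ltn_pmod q K0; have := divn_eq q K.
set a := (q %/ K)%N; set b := (q %% K)%N in bK * => qE.
have [lt|ge] := ltnP b.+1 K.
  have -> : (q.+1 %/ K)%N = a by rewrite qE -addnS divnMDl // divn_small ?addn0.
  have -> : (q.+1 %% K)%N = b.+1 by rewrite qE -addnS modnMDl modn_small.
  by rewrite ltn_add2l.
have q1 : q.+1 = (a.+1 * K)%N by rewrite mulSn; lia.
rewrite q1 mulnK // modnMl.
have := tK a; have := tK a.+1; rewrite mulSn; lia.
Qed.

(** The independence set consists of the terms of offset K of the blocks. Sliding the window of kept
    terms in each block gives these times any prescribed letters of the cyclic word. *)
Lemma cyclic_independent (G : group) (X : Type) (act : G -> X -> X) (k : nat)
    (g : nat -> G) (B : 'I_k.+2 -> set X) (M : set nat) :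
  cofinal M -> (forall i j z, B i z -> B j z -> i = j) ->
  (forall s, sorted ltn s -> (forall x, x \in s -> M x) ->
    exists z, forall i, (i < size s)%N ->
      B (inord (i %% k.+2)) (act (g (nth 0%N s i)) z)) ->
  exists J : set G, infinite_set J /\ indep_set act B J.
Proof.
move=> cM Bdisj real; have [//|u [ui uM]] := @cofinal_enum (fun=> M).
(* The two-term word has the letters 0 and 1, whose sets are disjoint, so the two group elements
   differ. *)
have ginj a b : (a < b)%N -> g (u a) <> g (u b).
  move=> ab gab; have [||z zP] := real [:: u a; u b].
  - by rewrite /= ui.
  - by move=> x; rewrite !inE => /orP[] /eqP ->.
  have := zP 0%N isT; have := zP 1%N isT; rewrite /= gab !modn_small // => h1 h0.
  have := Bdisj _ _ _ h1 h0 => /(congr1 (@nat_of_ord _)).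
  by rewrite !inordK.
pose K := k.+2; pose c t := g (u (t * (2 * K) + K)%N).
have cinj : injective c.
  have wlt t t' : (t < t')%N -> c t <> c t'.
    move=> tt'; apply: ginj.
    have : (t.+1 * (2 * K) <= t' * (2 * K))%N by rewrite leq_mul2r tt' orbT.
    by rewrite mulSn /K; lia.
  move=> t t' tt'; have [/wlt//|/wlt h|//] := ltngtP t t'.
  by exfalso; apply: h.
have /choice[h hP] : forall x, exists n, forall t, x = c t -> n = t.
  move=> x; have [[t xt]|no] := pselect (exists t, x = c t).
    by exists t => t'; rewrite xt => /cinj.
  by exists 0%N => t xt; exfalso; apply: no; exists t.
exists (range c); split.
  move=> /(finite_image h); apply: contra_not; last exact: infinite_nat.
  apply: sub_finite_set => t _; exists (c t); first by exists t.
  exact: hP.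
move=> I s fI I0 IJ.
have [T TP] := finite_set_nat_bounded (finite_image h fI).
pose t q : nat := s (c q).
have [||z zP] := real (mkseq (block_word u K t) (T * K)).
- apply: (homo_sorted (block_word_incr ui _)); first by move=> q; exact: ltn_ord.
  exact: iota_ltn_sorted.
- by move=> x /mapP[q _ ->]; exact: uM.
exists z => x Ix; have [q _ qx] := IJ x Ix.
have qT : (q < T)%N by apply: TP; exists x => //; exact: hP.
have tK : (t q < K)%N by exact: ltn_ord.
(* Position [q * K + t q] of the list carries the letter [t q] and holds the term of offset K of
   block [q]. *)
have idx : (q * K + t q < T * K)%N.
  by have : (q.+1 * K <= T * K)%N; [rewrite leq_mul2r qT orbT|rewrite mulSn; lia].
have := zP (q * K + t q)%N; rewrite size_mkseq nth_mkseq // => /(_ idx).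
rewrite /block_word modnMDl divnMDl // divn_small // addn0 modn_small //.
rewrite /K -/K -addnA subnK ?(ltnW tK) // -/(c q) qx /t.
by rewrite inord_val qx.
Qed.

Lemma pigeonhole_fibre (m k l : nat) (a : 'I_m -> 'I_l) :
  (k * l < m)%N ->
  exists b, exists2 c : 'I_k.+1 -> 'I_m, injective c & forall j, a (c j) = b.
Proof.
move=> klm.
have [b bP] : exists b, (k < #|[pred i | a i == b]|)%N.
  apply: contrapT => /forallNP no; move: klm; apply/negP; rewrite -leqNgt.
  have -> : (k * l = \sum_(b < l) k)%N by rewrite sum_nat_const card_ord mulnC.
  have mE : (m = \sum_(b < l) \sum_(i < m | a i == b) 1)%N.
    by rewrite -{1}(card_ord m) -sum1_card (partition_big a xpredT).
  rewrite {1}mE leq_sum // => b _.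
  by rewrite sum1_card; have /negP := no b; rewrite -leqNgt.
exists b, (fun j => enum_val (widen_ord bP j)).
  by move=> i j /enum_val_inj /(congr1 val) /= /val_inj.
by move=> j; have := enum_valP (widen_ord bP j); rewrite inE => /eqP.
Qed.

(** Both alternatives persist on subsets, so the last of the successive thinnings serves all of
    [L]. *)
Lemma galvin_family (I : eqType) (F : I -> seq nat -> Prop) (L : seq I) M :
  cofinal M -> exists N, [/\ N `<=` M, cofinal N & forall f, f \in L ->
  (forall s, sorted ltn s -> (forall x, x \in s -> N x) -> ~ F f s) \/
  (forall u, incr u -> (forall i, N (u i)) -> exists n, F f (mkseq u n))].
Proof.
elim: L M => [|f L IH] M cM; first by exists M; split => // f.
have [N [NM cN fN]] := galvin (F f) cM.
have [P [PN cP LP]] := IH N cN.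
exists P; split => //; first exact: subset_trans PN NM.
move=> f'; rewrite inE => /predU1P[->|/LP//].
case: fN => h; [left => s ss sP|right => u ui uP].
  by apply: h => // x /sP/PN.
by apply: h => // i; exact/PN.
Qed.

Theorem separated_independent (R : realType) (G : group) (X : pseudoMetricType R)
    (act : G -> X -> X) (k l m : nat) (g : nat -> G) (A : 'I_m -> set X) (r e : R) :
  compact [set: X] -> 0 < e -> e + e <= r -> (k.+1 * l < m)%N ->
  (forall i j u v, i != j -> A i u -> A j v -> ~ ball u (r + r) v) ->
  (forall s : nat -> 'I_m, exists x : 'I_l -> X,
     forall n, exists a, A (s n) (act (g n) (x a))) ->
  exists x : 'I_k.+2 -> X, (forall i j, i != j -> ~ ball (x i) r (x j)) /\
    exists J : set G, infinite_set J /\ indep_set act (fun i => ball (x i) e) J.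
Proof.
move=> cX e0 er klm Asep words.
have m0 : (0 < m)%N by exact: leq_ltn_trans klm.
have [Y Ynet] := finite_net cX e0.
have [x0 _] := words (fun=> Ordinal m0).
have [a0 _] : exists a : 'I_l, True.
  by have [x /(_ 0%N)[a _]] := words (fun=> Ordinal m0); exists a.
pose y (f : {ffun 'I_k.+2 -> 'I_(size Y)}) i := nth (x0 a0) Y (f i).
(* [F] collects the failures: if it contains no list of times from [N], the cyclic word is always
   realized. *)
pose F f (s : seq nat) := ~ exists z, forall i, (i < size s)%N ->
  ball (y f (inord (i %% k.+2))) e (act (g (nth 0%N s i)) z).
have [|N [_ cN alt]] := @galvin_family _ F (enum {ffun 'I_k.+2 -> 'I_(size Y)}) [set: nat].
  by move=> n; exists n.+1.
apply: contrapT => no.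
have bad f u : (forall i j, i != j -> ~ ball (y f i) r (y f j)) ->
    incr u -> (forall i, N (u i)) -> exists n, F f (mkseq u n).
  move=> fsep ui uN; have [real|] := alt f (mem_enum _ f); last by apply.
  exfalso; apply: no; exists (y f); split => //.
  apply: (@cyclic_independent _ _ _ _ g _ N) => //.
    move=> i j z iz jz; apply: contrapT => /eqP ij; apply: (fsep _ _ ij).
    by apply: le_ball (ball_triangle iz (ball_sym jz)).
  by move=> s ss sN; apply: contrapT => /(real _ ss sN).
have [//|b [bi bN]] := @cofinal_enum (fun=> N).
have /choice[h hb] : forall n, exists q, forall q', n = b q' -> q = q'.
  move=> n; have [[q qn]|nq] := pselect (exists q, n = b q).
    exists q => q'; rewrite qn.
    by have [/bi|/bi|//] := ltngtP q q'; lia.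
  by exists 0%N => q' nq'; exfalso; apply: nq; exists q'.
(* The time [b q] receives the letter q mod m, so each letter occurs infinitely often along the
   chosen times. *)
have [x xP] := words (fun n => Ordinal (ltn_pmod (h n) m0)).
have bge q : (q <= b q)%N.
  by elim: q => // q IH; have := bi q q.+1 (ltnSn q); lia.
have visit i : exists a, cofinal [set n | N n /\ A i (act (g n) (x a))].
  apply: (@cofinal_exists _ (fun n a => N n /\ A i (act (g n) (x a)))) => n.
  pose q := (n.+1 * m + i)%N.
  exists (b q).
    have [a aP] := xP (b q); exists a; split => //.
    move: aP; rewrite (_ : Ordinal _ = i) //; apply/val_inj => /=.
    by rewrite (hb _ q) // /q modnMDl modn_small.
  by apply: leq_trans (bge q); rewrite /q; nia.
have /choice[a aP] := visit.
(* A single one of the [l] points visits [k.+2] of the sets infinitely often. *)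
have [a1 [c cinj ca]] := pigeonhole_fibre a klm.
pose C j (t : 'I_(size Y)) n :=
  N n /\ (A (c j) (act (g n) (x a1)) /\ ball (nth (x0 a0) Y t) e (act (g n) (x a1))).
have /choice[t tP] : forall j, exists t, cofinal (C j t).
  move=> j; apply: (@cofinal_exists _ (fun n t => C j t n)) => n.
  have [p [Np Ap] np] := aP (c j) n; rewrite ca in Ap.
  exists p => //; have [v vY vp] := Ynet (act (g p) (x a1)).
  have vi : (index v Y < size Y)%N by rewrite index_mem.
  by exists (Ordinal vi); split => //; split => //=; rewrite nth_index.
pose f : {ffun 'I_k.+2 -> 'I_(size Y)} := [ffun j => t j].
have yf j : y f j = nth (x0 a0) Y (t j) by rewrite /y ffunE.
(* The visits are interleaved cyclically, so [x a1] realizes the very word that [bad] excludes. *)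
have [q|u [ui uC]] := @cofinal_enum (fun q => C (inord (q %% k.+2)) (t (inord (q %% k.+2)))).
  exact: tP.
have [|//|i|n] := bad f u; first 1 last.
- by have [] := uC i.
- apply; exists (x a1) => i; rewrite size_mkseq => iN; rewrite nth_mkseq // yf.
  by have [_ []] := uC i.
move=> i j ij yij.
have [p [_ [Ap yp]] _] := tP i 0%N; have [p' [_ [Ap' yp']] _] := tP j 0%N.
have cij : c i != c j by apply: contra_neq ij => /cinj.
apply: Asep cij Ap Ap' _; rewrite !yf in yij.
apply: le_ball (ball_triangle (ball_sym yp) (ball_triangle yij yp')).
lra.
Qed.

(** * Averages in equicontinuous systems *)

Definition orbit_sum (R : realType) (G : group) (H : Type) (act : G -> H -> H)
  (I : finType) (g : I -> G) (phi : H -> R) (h : H) : R := \sum_i phi (act (g i) h).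

(** The sums are not normalized: this bounds the oscillation of the averages by [t]. *)
Definition near_const (R : realType) (G : group) (H : Type) (act : G -> H -> H)
    (I : finType) (g : I -> G) (phi : H -> R) (t : R) :=
  exists a, forall h, a <= orbit_sum act g phi h <= a + t * #|I|%:R.

Definition cutoff (R : realType) (H : topologicalType) (phi : H -> R) :=
  continuous phi /\ forall h, 0 <= phi h <= 1.

Definition translate (G : group) (I J : finType) (g : I -> G) (k : J -> G)
  (ij : J * I) : G := gmul (g ij.2) (k ij.1).

Lemma orbit_sum_translate (R : realType) (G : group) (H : topologicalType)
    (act : G -> H -> H) (I J : finType) (g : I -> G) (k : J -> G) (phi : H -> R) h :
  is_action act ->
  orbit_sum act (translate g k) phi h = \sum_j orbit_sum act g phi (act (k j) h).
Proof.
case=> _ _ actM; rewrite /orbit_sum pair_big /=.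
by apply: eq_bigr => -[j i] _; rewrite /translate actM.
Qed.

Lemma near_const_translate (R : realType) (G : group) (H : topologicalType)
    (act : G -> H -> H) (I J : finType) (g : I -> G) (k : J -> G) (phi : H -> R) t :
  is_action act -> near_const act g phi t -> near_const act (translate g k) phi t.
Proof.
move=> actA [a aP]; exists (#|J|%:R * a) => h; rewrite orbit_sum_translate //.
have cst b : #|J|%:R * b = \sum_(j : J) b :> R by rewrite sumr_const mulr_natl.
rewrite card_prod natrM mulrCA -mulrDr !cst.
by apply/andP; split; apply: ler_sum => j _; have /andP[] := aP (act (k j) h).
Qed.

(** Some [k j] moves [h] close to the base point, which pins one of the |J| inner sums to within e
    |I| of a fixed value; the others range over an interval of length t |I|. The bound is written so
    that t - 2e is contracted by the factor 1 - 1/|J|. *)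
Lemma near_const_contract (R : realType) (G : group) (H : pseudoPMetricType R)
    (act : G -> H -> H) (I J : finType) (g : I -> G) (k : J -> G) (phi : H -> R)
    (t e d : R) :
  is_action act ->
  (forall y z, ball y d z -> forall g, `|phi (act g y) - phi (act g z)| <= e) ->
  (forall x y, exists j, ball y d (act (k j) x)) ->
  near_const act g phi t ->
  near_const act (translate g k) phi (e + e + (1 - #|J|%:R^-1) * (t - (e + e))).
Proof.
move=> actA phie hit [a aP].
have [j0 _] := hit point point.
have J0 : 0 < #|J|%:R :> R by rewrite ltr0n; apply/card_gt0P; exists j0.
set v := orbit_sum act g phi point.
exists (v - e * #|I|%:R + (#|J|%:R - 1) * a) => h.
rewrite orbit_sum_translate //; have [j jh] := hit h point.
rewrite (bigD1 j) //=.
have cst b : (#|J|%:R - 1) * b = \sum_(i | i != j) b :> R.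
  rewrite sumr_const -[RHS]mulr_natl; congr (_ * b).
  by rewrite cardC1 -[#|J|]prednK ?mulrSr ?addrK //; apply/card_gt0P; exists j.
have near : `|v - orbit_sum act g phi (act (k j) h)| <= e * #|I|%:R.
  rewrite /v /orbit_sum -sumrB (le_trans (ler_norm_sum _ _ _)) //.
  rewrite mulr_natr -sumr_const ler_sum // => i _; exact: phie.
have lo : (#|J|%:R - 1) * a <= \sum_(i | i != j) orbit_sum act g phi (act (k i) h).
  by rewrite cst ler_sum // => i _; have /andP[] := aP (act (k i) h).
have hi : \sum_(i | i != j) orbit_sum act g phi (act (k i) h) <=
    (#|J|%:R - 1) * (a + t * #|I|%:R).
  by rewrite cst ler_sum // => i _; have /andP[] := aP (act (k i) h).
move: near; rewrite ler_norml => /andP[n1 n2]; apply/andP; split; first by lra.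
rewrite card_prod natrM.
have -> : (e + e + (1 - #|J|%:R^-1) * (t - (e + e))) * (#|J|%:R * #|I|%:R) =
   (e + e) * #|I|%:R + (#|J|%:R - 1) * (t * #|I|%:R) :> R.
  by field; rewrite gt_eqF.
lra.
Qed.

Section equicontinuous_average.
Context (R : realType) (G : group) (H : pseudoPMetricType R) (act : G -> H -> H).
Hypotheses (cH : compact [set: H]) (actA : is_action act)
  (minH : minimal_sys act) (eqH : equicontinuous_sys act).

(** Minimality gives a group element for each pair of points of two finite nets; equicontinuity
    extends it to all points near the first one. *)
Lemma uniform_hitting (d : R) : 0 < d ->
  exists (J : finType) (k : J -> G), forall x y, exists j, ball y d (act (k j) x).
Proof.
move=> d0; have d3 : 0 < d / 3 by lra.
have [c c0 cP] := eqH d3.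
have [s sP] := finite_net cH c0; have [t tP] := finite_net cH d3.
have orb x y : exists g, ball y (d / 3) (act g x).
  have : closure [set act g x | g in [set: G]] y by rewrite minH.
  by move=> /(_ _ (nbhsx_ballx y _ d3))[_ [[g _ <-] yg]]; exists g.
have /choice[k kP] : forall ij : 'I_(size s) * 'I_(size t), exists g,
    ball (nth point t ij.2) (d / 3) (act g (nth point s ij.1)).
  by move=> ij; exact: orb.
exists ('I_(size s) * 'I_(size t))%type, k => x y.
have [x' x's xx'] := sP x; have [y' y't yy'] := tP y.
have i1 : (index x' s < size s)%N by rewrite index_mem.
have i2 : (index y' t < size t)%N by rewrite index_mem.
exists (Ordinal i1, Ordinal i2).
have := kP (Ordinal i1, Ordinal i2); rewrite /= !nth_index // => yx.
apply: le_ball (ball_triangle (ball_sym yy') (ball_triangle yx (cP _ _ xx' _))).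
lra.
Qed.

Lemma cutoff_orbit_equicontinuous (phi : H -> R) (e : R) : cutoff phi -> 0 < e ->
  exists2 d : R, 0 < d &
    forall y z, ball y d z -> forall g, `|phi (act g y) - phi (act g z)| <= e.
Proof.
move=> [cphi _] e0; have [d d0 dP] := compact_unif_continuous cH cphi e0.
have [c c0 cP] := eqH d0; exists c => // y z yz g.
by apply: ltW; exact: (dP _ _ (cP _ _ yz g)).
Qed.

(** Repeated contraction brings the oscillation from 1 towards e/2. The last clause lets several
    functions be treated one after the other. *)
Lemma near_const_exists (I : finType) (g : I -> G) (phi : H -> R) (e : R) :
  cutoff phi -> (0 < #|I|)%N -> 0 < e ->
  exists (I' : finType) (g' : I' -> G), [/\ (0 < #|I'|)%N, near_const act g' phi e &
    forall (psi : H -> R) (t : R), near_const act g psi t -> near_const act g' psi t].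
Proof.
move=> cphi I0 e0; have e4 : 0 < e / 4 by lra.
have [d d0 dP] := cutoff_orbit_equicontinuous cphi e4.
have [J [k kP]] := uniform_hitting d0.
have J0 : (0 < #|J|)%N by have [j _] := kP point point; apply/card_gt0P; exists j.
pose q : R := 1 - #|J|%:R^-1.
have iJ1 : #|J|%:R^-1 <= 1 :> R by rewrite invf_le1 ?ler1n ?ltr0n.
have iJ0 : 0 < #|J|%:R^-1 :> R by rewrite invr_gt0 ltr0n.
have iter n : exists (I' : finType) (g' : I' -> G), [/\ (0 < #|I'|)%N,
    near_const act g' phi (e / 4 + e / 4 + q ^+ n * (1 - (e / 4 + e / 4))) &
    forall (psi : H -> R) (t : R), near_const act g psi t -> near_const act g' psi t].
  elim: n => [|n [I' [g' [I'0 g'phi g'P]]]].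
    exists I, g; split => //; exists 0 => h.
    have -> : e / 4 + e / 4 + q ^+ 0 * (1 - (e / 4 + e / 4)) = 1 by rewrite expr0; ring.
    rewrite add0r mul1r /orbit_sum -[#|I|%:R]sumr_const.
    by apply/andP; split; [apply: sumr_ge0|apply: ler_sum] => i _;
      have [_ /(_ (act (g i) h)) /andP[]] := cphi.
  exists (J * I')%type, (translate g' k); split.
  - by rewrite card_prod muln_gt0 J0.
  - have := near_const_contract actA dP kP g'phi.
    suff <- : q * (e / 4 + e / 4 + q ^+ n * (1 - (e / 4 + e / 4)) - (e / 4 + e / 4)) =
        q ^+ n.+1 * (1 - (e / 4 + e / 4)) by [].
    by rewrite exprS; ring.
  - by move=> psi t /g'P; exact: near_const_translate.
have q0 n : 0 <= q ^+ n by rewrite exprn_ge0 // /q; lra.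
have q1 : `|q| < 1 by rewrite ger0_norm /q; lra.
have e2 : 0 < e / 2 by lra.
have /cvgrPdist_lt /(_ _ e2) [n _ /(_ n (leqnn n))] := cvg_expr q1.
rewrite /= sub0r normrN ger0_norm // => qn.
have [I' [g' [I'0 [a aP] g'P]]] := iter n.
exists I', g'; split => //; exists a => h; have /andP[-> /=] := aP h.
move=> /le_trans; apply; rewrite lerD2l ler_wpM2r //.
have := q0 n; nra.
Qed.

Lemma near_const_family (n : nat) (Phi : nat -> H -> R) (e : R) :
  (forall k, (k < n)%N -> cutoff (Phi k)) -> 0 < e ->
  exists (I : finType) (g : I -> G), (0 < #|I|)%N /\
    forall k, (k < n)%N -> near_const act g (Phi k) e.
Proof.
move=> cP e0; elim: n cP => [|n IH] cP.
  by exists unit, (fun=> gone G); split => //; rewrite card_unit.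
have [|I [g [I0 gP]]] := IH; first by move=> k kn; apply: cP; lia.
have [I' [g' [I'0 h1 h2]]] := near_const_exists g (cP n (ltnSn n)) I0 e0.
exists I', g'; split => // k; rewrite ltnS leq_eqVlt => /predU1P[->//|/gP].
exact: h2.
Qed.

Context (nu : probability (borel_type H) R).
Hypothesis nu_inv : forall (g : G) (A : set (borel_type H)), measurable A ->
  nu (act g @^-1` A) = nu A.

Lemma integral_orbit_count (I : finType) (g : I -> G) (D : set H) :
  closed D ->
  (\int[nu]_h (\sum_i (\1_D (act (g i) h))%:E) = #|I|%:R%:E * nu D)%E.
Proof.
move=> cD.
have [ca _ _] := actA.
have mD := closed_borel cD.
have mgD i : measurable (act (g i) @^-1` D : set (borel_type H)).
  by apply: closed_borel; apply: preimage_closed => // x _; exact: ca.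
have -> : (fun h => \sum_i (\1_D (act (g i) h))%:E)%E =
    (fun h => \sum_i (\1_(act (g i) @^-1` D) h)%:E)%E by [].
rewrite ge0_integral_sum //=; last first.
  by move=> i; apply/measurable_EFinP; exact: measurable_indic.
rewrite (eq_bigr (fun=> nu D)) => [|i _]; last first.
  by rewrite (integral_indic nu measurableT (mgD i)) setIT; exact: nu_inv.
rewrite -(@sumr_const _ I) -sumEFin ge0_sume_distrl //.
by apply: eq_bigr => i _; rewrite mul1e.
Qed.

Lemma measurable_orbit_count (I : finType) (g : I -> G) (D : set H) : closed D ->
  measurable_fun [set: borel_type H] (fun h : borel_type H => \sum_i (\1_D (act (g i) h) : R)%:E)%E.
Proof.
move=> cD; have [ca _ _] := actA.
apply: emeasurable_sum => i; apply/measurable_EFinP.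
have mgD : measurable (act (g i) @^-1` D : set (borel_type H)).
  by apply: closed_borel; apply: preimage_closed => // x _; exact: ca.
have : measurable_fun setT (\1_(act (g i) @^-1` D) : borel_type H -> R).
  exact: measurable_indic.
by [].
Qed.

Lemma measure_le_orbit_sum (I : finType) (g : I -> G) (D : set H) (phi : H -> R) (u : R) :
  closed D -> (forall h, D h -> 1 <= phi h) -> (forall h, 0 <= phi h) ->
  (forall h, orbit_sum act g phi h <= u) -> fine (nu D) * #|I|%:R <= u.
Proof.
move=> cD phi1 phi0 Su.
have mD := closed_borel cD.
rewrite -lee_fin EFinM fineK ?fin_num_measure // muleC -(integral_orbit_count g cD).
have -> : u%:E = (\int[nu]_(h in [set: borel_type H]) cst u%:E h)%E.
  by rewrite (integral_cst nu) // [X in (_ * X)%E](probability_setT nu) mule1.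
apply: ge0_le_integral => //.
- by move=> h _; apply: sume_ge0 => i _; rewrite lee_fin.
- exact: measurable_orbit_count.
move=> h _; rewrite sumEFin lee_fin; apply: le_trans (Su h).
apply: ler_sum => i _; rewrite indicE; case: (boolP (_ \in D)) => // /set_mem.
exact: phi1.
Qed.

Lemma orbit_sum_le_measure (I : finType) (g : I -> G) (D : set H) (phi : H -> R) (a : R) :
  closed D -> (forall h, ~ D h -> phi h <= 0) -> (forall h, phi h <= 1) ->
  (forall h, a <= orbit_sum act g phi h) -> a <= fine (nu D) * #|I|%:R.
Proof.
move=> cD phi0 phi1 aS.
have mD := closed_borel cD.
(* The comparison of integrals below is for nonnegative functions, so [a <= 0] is treated apart. *)
have [a0|a0] := leP a 0.
  by apply: le_trans a0 _; rewrite mulr_ge0 // fine_ge0.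
rewrite -lee_fin EFinM fineK ?fin_num_measure // muleC -(integral_orbit_count g cD).
have -> : a%:E = (\int[nu]_(h in [set: borel_type H]) cst a%:E h)%E.
  by rewrite (integral_cst nu) // [X in (_ * X)%E](probability_setT nu) mule1.
apply: ge0_le_integral => //.
- by move=> h _; rewrite lee_fin ltW.
- exact: measurable_orbit_count.
move=> h _; rewrite sumEFin lee_fin; apply: le_trans (aS h) _.
apply: ler_sum => i _; rewrite indicE; case: (boolP (_ \in D)) => [_ //|/negP nD].
by apply: phi0 => hD; apply: nD; exact/mem_set.
Qed.

(** * Thickenings and large finite sets *)

Definition thickening (C : set H) (r : R) : set H :=
  [set y | exists2 c, C c & ball c r y].

Lemma thickeningW C r s : r <= s -> thickening C r `<=` thickening C s.
Proof. by move=> rs y [c Cc cy]; exists c => //; exact: le_ball cy. Qed.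

Lemma closure_thickening C r s : 0 < s ->
  closure (thickening C r) `<=` thickening C (r + s).
Proof.
move=> s0 y /(_ _ (nbhsx_ballx y _ s0))[z [[c Cc cz] yz]].
by exists c => //; exact: ball_triangle cz (ball_sym yz).
Qed.

(** The margin [r] between the two thickenings makes the sets uniformly separated, so Urysohn's
    function applies. *)
Lemma thickening_cutoff C r : 0 < r -> exists phi : H -> R, [/\ cutoff phi,
  (forall h, thickening C r h -> phi h = 1) &
  (forall h, ~ thickening C (r + r) h -> phi h = 0)].
Proof.
move=> r0; pose A := ~` thickening C (r + r); pose B := thickening C r.
have sepAB : uniform_separator A B.
  apply: uniform_separatorW; exists [set xy | ball xy.1 r xy.2].
    exact: entourage_ball (PosNum r0).
  rewrite predeqE => -[x y]; split => // -[[/= nx [c Cc cy]] xy].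
  by apply: nx; exists c => //; exact: ball_triangle cy (ball_sym xy).
exists (Urysohn A B); split.
- split; first exact: Urysohn_continuous.
  move=> h; have : range (@Urysohn _ R A B) (Urysohn A B h) by exists h.
  by move/Urysohn_range; rewrite /= in_itv.
- by move=> h Bh; apply: (Urysohn_sub1 sepAB); exists h.
- by move=> h Ah; apply: (Urysohn_sub0 sepAB); exists h.
Qed.

(* Avoids the Haar measure of the enveloping group: that the group elements
   moving P into C have positive measure is expressed through finite families g
   that equidistribute the given test functions Phi. *)
Definition large (C : set H) (P : seq H) := exists2 a : R, 0 < a &
  forall (r : R) (n : nat) (Phi : nat -> H -> R) (e : R),
  0 < r -> (forall k, (k < n)%N -> cutoff (Phi k)) -> 0 < e ->
  exists (I : finType) (g : I -> G), [/\ (0 < #|I|)%N,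
    forall k, (k < n)%N -> near_const act g (Phi k) e &
    a * #|I|%:R <=
      \sum_i (`[< forall h, h \in P -> thickening C r (act (g i) h) >])%:R].

(** A cutoff around [C] joins the test functions. Its averages are nearly constant and its integral
    is at least [nu C], so the average at [h0] is at least half of that; the cutoff is bounded by
    the indicator of the thickening. *)
Lemma large_seq1 (C : set H) (h0 : H) : closed C -> (0 < nu C)%E -> large C [:: h0].
Proof.
move=> cC nuC.
have mC := closed_borel cC.
have c0 : 0 < fine (nu C) by rewrite fine_gt0 // nuC ltey_eq fin_num_measure.
exists (fine (nu C) / 2); first by lra.
move=> r n Phi e r0 cPhi e0; have r2 : 0 < r / 2 by lra.
have [phi [cphi phi1 phi0]] := thickening_cutoff C r2.
have [||I [g [I0 gP]]] := @near_const_family n.+1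
    (fun k => if k == n then phi else Phi k) (Num.min e (fine (nu C) / 2)).
- by move=> k; case: eqP => // kn kn1; apply: cPhi; lia.
- by rewrite lt_min e0; lra.
have e1 : Num.min e (fine (nu C) / 2) <= e by rewrite ge_min lexx.
have e2 : Num.min e (fine (nu C) / 2) <= fine (nu C) / 2 by rewrite ge_min lexx orbT.
exists I, g; split => //.
  move=> k kn; have := gP k (ltnW kn); rewrite ifN; last by rewrite ltn_eqF.
  move=> [a aP]; exists a => h; have /andP[-> /= /le_trans ->] // := aP h.
  by rewrite lerD2l ler_wpM2r.
have := gP n (ltnSn n); rewrite eqxx => -[a aP].
have le1 : fine (nu C) * #|I|%:R <= a + fine (nu C) / 2 * #|I|%:R.
  apply: (measure_le_orbit_sum cC (phi := phi) (g := g)).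
  - by move=> h Ch; rewrite phi1 //; exists h => //; exact: ballxx.
  - by move=> h; case: cphi => _ /(_ h)/andP[].
  - move=> h; have /andP[_ /le_trans ->] // := aP h.
    by rewrite lerD2l ler_wpM2r.
have /andP[le2 _] := aP h0.
apply: (@le_trans _ _ a); first by lra.
apply: le_trans le2 _; apply: ler_sum => i _.
case: asboolP => [_|nP]; first by case: cphi => _ /(_ (act (g i) h0))/andP[].
rewrite phi0 // -splitr => th; apply: nP => h; rewrite inE => /eqP ->.
exact: th.
Qed.

(* If g h is in C and g h' is not, for h' close to h, then g h' lies in a thin
   shell around C; the frequency of such g is controlled by the measure of the
   shell. The infimum c of the measures of the thickenings of C makes these
   measures as small as needed. *)
Lemma large_perturb (C : set H) (P : seq H) (N : nat) : large C P ->
  exists2 d : R, 0 < d & forall P' : seq H, (size P' <= N)%N ->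
    (forall h', h' \in P' -> exists2 h, h \in P & ball h d h') -> large C P'.
Proof.
move=> [a a0 aP].
pose S : set R := [set fine (nu (closure (thickening C r))) | r in [set r | 0 < r]].
pose c := inf S.
have S0 : has_inf S.
  split; first by exists (fine (nu (closure (thickening C 1)))); exists 1 => //=.
  by exists 0 => _ [r _ <-]; rewrite fine_ge0.
have clo r : closed (closure (thickening C r)) by exact: closed_closure.
have c1 r : 0 < r -> c <= fine (nu (closure (thickening C r))).
  by move=> r0; apply: ge_inf; [case: S0|exists r].
(* Each point of [P'] will cost a proportion of at most 3k, and (N + 1) 4k = a/2 is half of the
   given proportion. *)
pose k := a / (8 * N.+1%:R).
have N0 : 0 < N.+1%:R :> R by rewrite ltr0n.
have k0 : 0 < k by rewrite divr_gt0 // mulr_gt0.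
have [_ [R0 /= R00 <-] R0c] := inf_adherent k0 S0.
have R4 : 0 < R0 / 4 by lra.
have R2 : 0 < R0 / 2 by lra.
have [psi [cpsi psi1 psi0]] := thickening_cutoff C R2.
(* Points [d]-close have orbits R0/4-close; with [r1] at most R0/4, the perturbed point stays within
   R0/2 of [C], where [psi] is 1. *)
have [d d0 dP] := eqH R4.
exists d => // P' sP' PP'; exists (a / 2); first by lra.
move=> r n Phi e r0 cPhi e0.
pose r1 := Num.min r (R0 / 4).
have r10 : 0 < r1 by rewrite lt_min r0.
have r1r : r1 <= r by rewrite ge_min lexx.
have r1R : r1 <= R0 / 4 by rewrite ge_min lexx orbT.
have r12 : 0 < r1 / 2 by lra.
have r14 : 0 < r1 / 4 by lra.
have [phi [cphi phi1 phi0]] := thickening_cutoff C r12.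
rewrite -splitr in phi0; rewrite -splitr in psi0.
pose e1 := Num.min e k.
have e10 : 0 < e1 by rewrite lt_min e0.
have e1e : e1 <= e by rewrite ge_min lexx.
have e1k : e1 <= k by rewrite ge_min lexx orbT.
have [|||I [g [I0 gP cnt]]] := aP r1 n.+2
  (fun k => if k == n then phi else if k == n.+1 then psi else Phi k) e1 => //.
  move=> j; case: eqP => // jn; case: eqP => // jn1 jn2; apply: cPhi.
  by clear -jn jn1 jn2; lia.
exists I, g; split => //.
  move=> j jn; have := gP j (leq_trans jn (leqW (leqnSn n))).
  rewrite !ifN; [|by rewrite ltn_eqF // ltnW|by rewrite ltn_eqF].
  move=> [b bP]; exists b => h; have /andP[-> /= /le_trans ->] // := bP h.
  by rewrite lerD2l ler_wpM2r.
have := gP n (leqnSn n.+1); rewrite eqxx => -[aphi aphiP].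
have := gP n.+1 (ltnSn n.+1); rewrite eqxx ifN; last by rewrite gtn_eqF.
move=> [apsi apsiP].
have phi01 h : 0 <= phi h <= 1 by case: cphi.
have psi01 h : 0 <= psi h <= 1 by case: cpsi.
(* On the closure of the thickening by r1/4, whose measure is at least [c], the function [phi] is
   1. *)
have lephi : c * #|I|%:R <= aphi + e1 * #|I|%:R.
  apply: le_trans (_ : fine (nu (closure (thickening C (r1 / 4)))) * #|I|%:R <= _).
    by rewrite ler_wpM2r // c1.
  apply: (measure_le_orbit_sum (clo _) (phi := phi) (g := g)).
  - move=> h /(closure_thickening r14) th; rewrite phi1 //.
    by apply: thickeningW th; lra.
  - by move=> h; case/andP: (phi01 h).
  - by move=> h; have /andP[] := aphiP h.
have lepsi : apsi <= (c + k) * #|I|%:R.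
  apply: (@le_trans _ _ (fine (nu (closure (thickening C R0))) * #|I|%:R)).
    apply: (orbit_sum_le_measure (clo _) (phi := psi) (g := g)).
    - by move=> h nh; rewrite psi0 // => th; apply: nh; exact: subset_closure.
    - by move=> h; case/andP: (psi01 h).
    - by move=> h; have /andP[] := apsiP h.
  by rewrite ler_wpM2r // ltW.
have phipsi h : phi h <= psi h.
  have [th|nth] := pselect (thickening C (R0 / 2) h).
    by rewrite psi1 //; case/andP: (phi01 h).
  rewrite phi0; first by case/andP: (psi01 h).
  by move=> th; apply: nth; apply: thickeningW th; lra.
(* If [g i] is good for [P] but not for [P'], some point of [P'] has an image with [psi] = 1 and
   [phi] = 0; the other terms are nonnegative. *)
have pw i : (`[< forall h, h \in P -> thickening C r1 (act (g i) h) >])%:R <=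
    (`[< forall h, h \in P' -> thickening C r (act (g i) h) >])%:R +
    \sum_(h <- P') (psi (act (g i) h) - phi (act (g i) h)) :> R.
  have tail (L : seq H) : 0 <= \sum_(h <- L) (psi (act (g i) h) - phi (act (g i) h)).
    by apply: sumr_ge0 => h _; rewrite subr_ge0.
  case: asboolP => [good|_]; last by rewrite addr_ge0.
  case: asboolP => [_|ngood]; first by rewrite lerDl.
  have [h' /not_implyP[h'P' nth]] : exists h', ~ (h' \in P' -> thickening C r (act (g i) h')).
    by apply/existsNP.
  rewrite add0r (big_rem h') //=.
  have [h hP hh'] := PP' h' h'P'.
  have [x Cx xh] := good h hP.
  have -> : psi (act (g i) h') = 1.
    apply: psi1; exists x => //.
    by apply: le_ball (ball_triangle xh (dP _ _ hh' (g i))); lra.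
  have -> : phi (act (g i) h') = 0.
    by apply: phi0 => th; apply: nth; exact: thickeningW th.
  by rewrite subr0 lerDl.
have tot : a * #|I|%:R <=
    \sum_i (`[< forall h, h \in P' -> thickening C r (act (g i) h) >])%:R +
    \sum_(h <- P') (orbit_sum act g psi h - orbit_sum act g phi h).
  apply: le_trans cnt _; apply: le_trans (ler_sum _ (fun i _ => pw i)) _.
  rewrite big_split /= lerD2l exchange_big /=; apply: ler_sum => h _.
  by rewrite sumrB.
have bound : \sum_(h <- P') (orbit_sum act g psi h - orbit_sum act g phi h) <=
    a / 2 * #|I|%:R.
  apply: (@le_trans _ _ (\sum_(h <- P') (3 * k * #|I|%:R))).
    apply: ler_sum => h _; have /andP[_ h1] := apsiP h; have /andP[h2 _] := aphiP h.
    have ek : e1 * #|I|%:R <= k * #|I|%:R by rewrite ler_wpM2r.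
    lra.
  rewrite big_const_seq count_predT iter_addr_0 -[leLHS]mulr_natl.
  have sN : (size P')%:R <= N.+1%:R :> R by rewrite ler_nat leqW.
  have -> : a / 2 * #|I|%:R = N.+1%:R * (4 * k * #|I|%:R).
    by rewrite /k; field; rewrite gt_eqF.
  apply: ler_pM => //; first by rewrite !mulr_ge0 // ltW.
  by rewrite ler_wpM2r // ler_wpM2r ?(ltW k0) //; lra.
lra.
Qed.

End equicontinuous_average.

(** * Visits of arbitrary words *)

Lemma act_ginvK (G : group) (H : topologicalType) (act : G -> H -> H) (g : G) :
  is_action act -> cancel (act g) (act (ginv g)).
Proof. by case=> _ act1 actM x; rewrite -actM gmulV act1. Qed.

Lemma act_ginvKV (G : group) (H : topologicalType) (act : G -> H -> H) (g : G) :
  is_action act -> cancel (act (ginv g)) (act g).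
Proof.
move=> actA x; apply: (can_inj (act_ginvK (ginv g) actA)).
exact: act_ginvK.
Qed.

Lemma common_radius (R : realType) (H : pseudoMetricType R) (P : seq H)
    (B : H -> set H) : (forall h, h \in P -> nbhs h (B h)) ->
  exists2 b : R, 0 < b & forall h, h \in P -> ball h b `<=` B h.
Proof.
elim: P => [|h P IH] PB; first by exists 1.
have [|b b0 bP] := IH; first by move=> x xP; apply: PB; rewrite inE xP orbT.
have /nbhs_ballP[c /= c0 cP] := PB h (mem_head _ _).
exists (Num.min b c); first by rewrite lt_min b0.
move=> x; rewrite inE => /predU1P[->|xP] y xy.
  by apply: cP; apply: le_ball xy; rewrite ge_min lexx orbT.
by apply: (bP x xP); apply: le_ball xy; rewrite ge_min lexx.
Qed.

Section independent_visits.
Context (R : realType) (G : group) (H : pseudoPMetricType R) (act : G -> H -> H).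
Hypotheses (cH : compact [set: H]) (actA : is_action act)
  (minH : minimal_sys act) (eqH : equicontinuous_sys act).
Context (nu : probability (borel_type H) R).
Hypothesis nu_inv : forall (g : G) (A : set (borel_type H)), measurable A ->
  nu (act g @^-1` A) = nu A.
Context (m : nat) (V : 'I_m -> set H).
Let C : set H := \bigcap_i closure (V i).

(** Some [g] moves all of [P] near [C], which lies in the closure of each [V i]; so each point of
    [P] can be perturbed into [m] points, one for each [V i]. The number of new points is known
    before the size of the perturbation is fixed, so largeness survives. *)
Lemma large_extend (P : seq H) (B : H -> set H) : large act C P ->
  (forall h, h \in P -> nbhs h (B h)) ->
  exists (g : G) (f : H -> 'I_m -> H),
    (forall h i, h \in P -> B h (f h i) /\ V i (act g (f h i))) /\
    large act C [seq f h i | h <- P, i <- enum 'I_m].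
Proof.
move=> lP PB; have [b b0 bP] := common_radius PB.
have [d d0 dP] := large_perturb actA eqH nu_inv (size P * m)%N lP.
have bd0 : 0 < Num.min b d by rewrite lt_min b0.
have [d2 d20 d2P] := eqH bd0.
have d22 : 0 < d2 / 2 by lra.
have [a a0 aP] := lP.
have [|||I [g [I0 _ cnt]]] := aP (d2 / 2) 0%N (fun _ _ => 0) 1 => //.
have [i gi] : exists i, forall h, h \in P -> thickening C (d2 / 2) (act (g i) h).
  apply: contrapT => /forallNP no; move: cnt; rewrite big1; last first.
    by move=> i _; case: asboolP => // /no.
  by apply/negP; rewrite -ltNge mulr_gt0 // ltr0n.
have /choice[f fP] : forall h, exists f : 'I_m -> H, h \in P ->
    forall j, ball h (Num.min b d) (f j) /\ V j (act (g i) (f j)).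
  move=> h; have [hP|] := boolP (h \in P); last by exists (fun=> h).
  have [c Cc cgh] := gi h hP.
  have /choice[f fP] : forall j, exists y, ball h (Num.min b d) y /\ V j (act (g i) y).
    move=> j; have [v [Vv cv]] := Cc j Logic.I _ (nbhsx_ballx c _ d22).
    exists (act (ginv (g i)) v); rewrite act_ginvKV //; split => //.
    (* Equicontinuity is used for the inverse of [g i], which carries points near [act (g i) h] back
       near [h]. *)
    rewrite -{1}(act_ginvK (g i) actA h); apply: d2P.
    by rewrite (splitr d2); exact: ball_triangle (ball_sym cgh) cv.
  by exists f => _.
exists (g i), f; split.
  move=> h j hP; have [hf Vf] := fP h hP j; split => //.
  by apply: (bP h hP); apply: le_ball hf; rewrite ge_min lexx.
apply: dP; first by rewrite size_allpairs size_enum_ord.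
move=> h' /allpairsP[[h j] /= [hP _ ->]]; exists h => //.
have [hf _] := fP h hP j; apply: le_ball hf.
by rewrite ge_min lexx orbT.
Qed.

(** The recursion carries a length, group elements and a large finite set that contains a witness
    for every word of that length. *)
Lemma independent_visits : (forall i, open (V i)) -> closed C -> (0 < nu C)%E ->
  exists g : nat -> G, forall (n : nat) (s : nat -> 'I_m),
    exists h, forall j, (j < n)%N -> V (s j) (act (g j) h).
Proof.
move=> oV cC nuC.
pose T := (nat * (nat -> G) * seq H)%type.
pose inv (x : T) := large act C x.2 /\
  forall s : nat -> 'I_m, exists2 h, h \in x.2 &
    forall j, (j < x.1.1)%N -> V (s j) (act (x.1.2 j) h).
pose Rel (x y : T) := [/\ y.1.1 = x.1.1.+1,
  forall j, (j < x.1.1)%N -> y.1.2 j = x.1.2 j & inv x -> inv y].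
have [|f [f0 fR]] := @dependent_choice T Rel _ (0%N, fun=> gone G, [:: point]).
  move=> [[n gs] P]; apply: cid.
  have [[/= lP iP]|ninv] := pselect (inv (n, gs, P)); last by exists (n.+1, gs, P); split.
  (* On this neighbourhood of [h] the visits already secured persist. *)
  pose B h := [set h' | forall (j : 'I_n) (i : 'I_m),
    V i (act (gs j) h) -> V i (act (gs j) h')].
  have [|g [f [fB lf]]] := large_extend (B := B) lP.
    move=> h _; apply: filter_forall => j; apply: filter_forall => i.
    have [Vh|nV] := pselect (V i (act (gs j) h)); last exact: nearW.
    have [ca _ _] := actA.
    have : nbhs h (act (gs j) @^-1` V i) by apply: ca; exact: open_nbhs_nbhs.
    by apply: filterS => h' Vh' _.
  exists (n.+1, (fun j => if j == n then g else gs j), [seq f h i | h <- P, i <- enum 'I_m]).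
  split => //=; first by move=> j jn; rewrite ltn_eqF.
  move=> _; split => //= s; have [h hP hV] := iP s.
  exists (f h (s n)); first by apply: allpairs_f; rewrite ?mem_enum.
  move=> j; rewrite ltnS leq_eqVlt => /predU1P[->|jn].
    by rewrite eqxx; case: (fB h (s n) hP).
  rewrite ltn_eqF //; have [Bf _] := fB h (s n) hP.
  exact: (Bf (Ordinal jn) (s j) (hV j jn)).
have f1 n : (f n).1.1 = n.
  by elim: n => [|n IH]; [rewrite f0|have [-> _ _] := fR n; rewrite IH].
have finv n : inv (f n).
  elim: n => [|n IH]; last by have [_ _] := fR n; apply.
  rewrite f0; split => /=; first exact: (large_seq1 cH actA minH eqH nu_inv).
  by move=> s; exists point; rewrite ?inE.
(* Group elements once chosen never change, so the final sequence is read off the diagonal. *)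
have stable n j : (j < n)%N -> (f n).1.2 j = (f j.+1).1.2 j.
  elim: n => // n IH; rewrite ltnS leq_eqVlt => /predU1P[->//|jn].
  by have [_ -> //] := fR n; rewrite ?f1 // IH.
exists (fun j => (f j.+1).1.2 j) => n s.
have [_ /(_ s)[h _ hV]] := finv n; exists h => j jn.
by rewrite -(stable n j jn); apply: hV; rewrite f1.
Qed.

End independent_visits.

(** * Baire category and semi-openness of factor maps *)

(** Each ball of doubled radius lies in the previous ball and in one more of the open sets; the
    ultralimit of the centres lies in all the doubled balls. *)
Lemma compact_baire (R : realType) (H : pseudoMetricType R) (U : nat -> set H) :
  compact [set: H] -> (forall n, open (U n) /\ dense (U n)) ->
  dense (\bigcap_n U n).
Proof.
move=> cH Ud O [x0 Ox0] oO.
have /nbhs_ballP[r0 /= r00 r0O] : nbhs x0 O by exact: open_nbhs_nbhs.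
pose Rel (a b : nat * (H * R)) := 0 < a.2.2 -> [/\ b.1 = a.1.+1, 0 < b.2.2 &
  ball b.2.1 (b.2.2 + b.2.2) `<=` ball a.2.1 a.2.2 `&` U a.1].
have [|f [f0 fR]] := @dependent_choice _ Rel _ (0%N, (x0, r0 / 2)).
  move=> [n [x r]]; apply: cid; have [r_gt0|nr] := pselect (0 < r); last first.
    by exists (0%N, (x, r)) => /= /nr.
  have [oU dU] := Ud n.
  have [|y [By Uy]] := dU (ball x r)° _ (open_interior _).
    by exists x; exact: nbhsx_ballx.
  have /nbhs_ballP[s /= s0 sP] : nbhs y ((ball x r)° `&` U n).
    by apply: open_nbhs_nbhs; split => //; apply: openI => //; exact: open_interior.
  exists (n.+1, (y, s / 2)) => _; split => //=; first by lra.
  by rewrite -splitr => z /sP[/interior_subset].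
have fpos n : 0 < (f n).2.2.
  elim: n => [|n IH]; first by rewrite f0 /=; lra.
  by case: (fR n IH).
have f1 n : (f n).1 = n.
  by elim: n => [|n IH]; [rewrite f0|case: (fR n (fpos n)) => -> _ _; rewrite IH].
have nested n k : ball (f (k + n)%N).2.1 (f (k + n)%N).2.2 `<=` ball (f n).2.1 (f n).2.2.
  elim: k => // k IH; apply: subset_trans IH; rewrite addSn => y yb.
  have [_ _ /(_ y)] := fR (k + n)%N (fpos _); case=> //.
  by apply: le_ball yb; rewrite lerDl ltW.
have [F [FU oF]] := @ultraFilterLemma _ (\oo : set_system nat) _.
have FP := @ultra_proper _ _ FU.
have [l fl] := ultra_cvg (fun n => (f n).2.1) cH FU.
have lb n : ball (f n).2.1 ((f n).2.2 + (f n).2.2) l.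
  have [k /= [bk nk]] : exists k, ball l (f n).2.2 (f k).2.1 /\ (n <= k)%N.
    apply: (@filter_ex _ F); apply: filterI.
      by apply: fl; exact: nbhsx_ballx.
    by apply: oF; exists n.
  apply: ball_triangle (ball_sym bk).
  by have := @nested n (k - n)%N; rewrite subnK //; apply; exact: ballxx.
exists l; split.
  by apply: r0O; have := lb 0%N; rewrite f0 /= -splitr.
by move=> n _; have [_ _ /(_ l (lb n.+1))[]] := fR n (fpos n); rewrite f1.
Qed.

(** If the image of the closure of a small ball had empty interior, Baire's theorem would give a
    point of [H] whose countably many translates all miss this image; but by minimality the orbit of
    a point of its fibre enters the ball. *)
Lemma minimal_semi_open (R : realType) (G : group) (X H : pseudoMetricType R)
    (actX : G -> X -> X) (actH : G -> H -> H) (p : X -> H) (U : set X) :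
  countable [set: G] -> compact [set: X] -> compact [set: H] -> hausdorff_space H ->
  is_action actH -> minimal_sys actX -> factor_map actX actH p ->
  open U -> U !=set0 -> (p @` U)° !=set0.
Proof.
move=> /countable_injP[e einj] cX cH hH actA minX [cp psurj pequiv] oU [x Ux].
have [ca _ _] := actA.
have /nbhs_ballP[s /= s0 sU] : nbhs x U by exact: open_nbhs_nbhs.
have s2 : 0 < s / 2 by lra.
pose D := closure (ball x (s / 2)).
have DU : D `<=` U.
  move=> y /(_ _ (nbhsx_ballx y _ s2))[z [xz yz]]; apply: sU.
  by rewrite (splitr s); exact: ball_triangle xz (ball_sym yz).
have cpD : closed (p @` D).
  apply: compact_closed => //; apply: continuous_compact.
    exact: continuous_subspaceT.
  by apply: subclosed_compact cX _; [exact: closed_closure|].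
apply: contrapT => /set0P/negP; rewrite negbK => /eqP int0.
have intD0 y : ~ (p @` D)° y.
  by move=> iy; suff : set0 y by []; rewrite -int0; apply: interiorS iy; exact: image_subset.
(* The injection [e] indexes the translates by naturals; a number that codes no group element gives
   the whole space. *)
pose W n := [set h | forall g, e g = n -> ~ (p @` D) (actH g h)].
have Wod n : open (W n) /\ dense (W n).
  have [[g gn]|ng] := pselect (exists g, e g = n); last first.
    have -> : W n = setT by apply/seteqP; split => // h _ g gn; exfalso; apply: ng; exists g.
    by split; [exact: openT|move=> O O0 _; rewrite setIT].
  have -> : W n = actH g @^-1` (~` (p @` D)).
    apply/seteqP; split => [h /(_ g gn)//|h Dh g' gn'].
    by rewrite (einj g' g) ?inE // gn.
  split; first by apply: open_comp => [y _|]; [exact: ca|exact: closed_openC].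
  move=> O [h Oh] oO; apply: contrapT => no.
  apply: (intD0 (actH g h)).
  suff : actH (ginv g) @^-1` O `<=` (p @` D)° by apply; rewrite /= act_ginvK.
  rewrite -open_subsetE; last by apply: open_comp => // y _; exact: ca.
  move=> y Oy; apply: contrapT => nD; apply: no; exists (actH (ginv g) y); split => //=.
  by rewrite act_ginvKV.
have [|h [_ hW]] := compact_baire cH Wod (O := setT) _ openT.
  by exists (p x).
have [z pz] := psurj h.
have : closure [set actX g z | g in [set: G]] x by rewrite minX.
move=> /(_ _ (nbhsx_ballx x _ s2))[_ [[g _ <-] xg]].
apply: (hW (e g) I g erefl); exists (actX g z); first exact: subset_closure.
by rewrite pequiv pz.
Qed.

(** Semi-openness is applied to the part of [U] above an arbitrary neighbourhood of [p x]. *)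
Lemma image_sub_closure_interior (R : realType) (G : group) (X H : pseudoMetricType R)
    (actX : G -> X -> X) (actH : G -> H -> H) (p : X -> H) (U : set X) :
  countable [set: G] -> compact [set: X] -> compact [set: H] -> hausdorff_space H ->
  is_action actH -> minimal_sys actX -> factor_map actX actH p ->
  open U -> p @` U `<=` closure (p @` U)°.
Proof.
move=> cG cX cH hH actA minX fp oU _ [x Ux <-] B Bpx.
have [cp _ _] := fp.
have : (p @` (U `&` (p @^-1` B)°))° !=set0.
  apply: minimal_semi_open fp _ _ => //.
    by apply: openI => //; exact: open_interior.
  by exists x; split => //; exact: cp.
move=> [y iy]; exists y; split.
  by apply: interiorS iy; apply: image_subset; exact: subIsetl.
by have [z [_ /interior_subset pzB] <-] := interior_subset iy.
Qed.

Lemma residual_dense (R : realType) (H : pseudoMetricType R) (A : set H) :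
  compact [set: H] -> residual A -> dense A.
Proof.
move=> cH [U [Uod UA]] O O0 oO.
by have [h [Oh Uh]] := compact_baire cH Uod O0 oO; exists h; split => //; exact: UA.
Qed.

(** * Cardinality of fibres and a tuple of positive measure *)

Lemma card_is_inj (T : choiceType) (A : set T) (K : natinf) (m : nat) :
  card_is A K -> (if K is Fin n then m <= n else true)%N ->
  exists2 c : 'I_m -> T, injective c & forall i, A (c i).
Proof.
case: K => [n|] /= cA mn; last first.
  have [B BA mB] := infinite_set_fset m cA.
  have [x0 _] := infinite_setN0 cA.
  have szB (i : 'I_m) : (i < size (finmap.enum_fset B))%N by exact: leq_trans mB.
  exists (fun i => nth x0 (finmap.enum_fset B) i).
    move=> i j /eqP; rewrite nth_uniq ?finmap.fset_uniq // => /eqP; exact: val_inj.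
  by move=> i; apply: BA; rewrite /= mem_nth.
have /card_set_bijP[f [_ finj fsurj]] := cA.
have /choice[c cP] : forall i : 'I_m, exists x, A x /\ f x = i.
  by move=> i; have [x Ax fx] := fsurj i (leq_trans (ltn_ord i) mn); exists x.
exists c; last by move=> i; case: (cP i).
move=> i j /(congr1 f); have [_ ->] := cP i; have [_ ->] := cP j; exact: val_inj.
Qed.

Lemma card_is_surj (T : Type) (A : set T) (n : nat) :
  card_is A (Fin n) -> exists c : 'I_n -> T, forall x, A x -> exists i, c i = x.
Proof.
move=> /card_set_bijP[f [ffun finj fsurj]].
have /choice[c cP] : forall i : 'I_n, exists x, A x /\ f x = i.
  by move=> i; have [x Ax fx] := fsurj i (ltn_ord i); exists x.
exists c => x Ax; have fxn : (f x < n)%N by exact: ffun.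
exists (Ordinal fxn); have [Ac fc] := cP (Ordinal fxn).
by apply: finj; rewrite ?inE.
Qed.

Lemma hausdorff_separation (R : realType) (X : pseudoMetricType R) (m : nat)
    (c : 'I_m -> X) : hausdorff_space X -> injective c ->
  exists2 r : R, 0 < r & forall i j, i != j -> ~ ball (c i) r (c j).
Proof.
move=> hX cinj.
have ex (ij : 'I_m * 'I_m) : \forall r \near (0:R)^'+, ij.1 != ij.2 ->
    ~ ball (c ij.1) r (c ij.2).
  have [ijE|ijN] := eqVneq ij.1 ij.2; first exact: nearW.
  have cN : c ij.1 != c ij.2 by apply: contra_neq ijN => /cinj.
  rewrite ball_hausdorff in hX; have [[r1 r2] /= /eqP r0] := hX _ _ cN.
  near=> r => _ cr; suff : set0 (c ij.2) by [].
  rewrite -r0; split; last exact: ballxx.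
  by apply: le_ball cr; near: r; exact: nbhs_right_le.
have /filter_ex[r [r0 rP]] : \forall r \near (0:R)^'+, 0 < r /\ forall ij : 'I_m * 'I_m,
    ij.1 != ij.2 -> ~ ball (c ij.1) r (c ij.2).
  by apply: filterI; [exact: nbhs_right_gt|exact: (@filter_forall _ _
    (fun (ij : 'I_m * 'I_m) r => ij.1 != ij.2 -> ~ ball (c ij.1) r (c ij.2)) _ _ ex)].
by exists r => // i j; exact: (rP (i, j)).
Unshelve. all: by end_near.
Qed.

(* The countably many candidate tuples of balls, with centres in finite nets of
   mesh tending to 0, exhaust the fibres with at least m points. *)
Lemma positive_measure_tuple (R : realType) (G : group) (X : pseudoMetricType R)
    (H : pseudoPMetricType R) (actX : G -> X -> X) (actH : G -> H -> H)
    (p : X -> H) (nu : probability (borel_type H) R) (m : nat) (Y : set H) :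
  countable [set: G] -> compact [set: X] -> hausdorff_space X ->
  compact [set: H] -> hausdorff_space H ->
  is_action actH -> minimal_sys actX -> factor_map actX actH p ->
  measurable (Y : set (borel_type H)) -> nu Y = 1%E ->
  (forall y, Y y -> exists2 c : 'I_m -> X, injective c & forall i, p (c i) = y) ->
  exists (r : R) (U : 'I_m -> set X), [/\ 0 < r, forall i, open (U i),
    forall i j u v, i != j -> closure (U i) u -> closure (U j) v -> ~ ball u (r + r) v &
    (0 < nu (\bigcap_i closure (p @` U i)°))%E].
Proof.
move=> cG cX hX cH hH actA minX fp mY nuY Yc.
have [cp psurj _] := fp; have [x0 _] := psurj point.
pose q n : R := n.+1%:R^-1.
have q0 n : 0 < q n by rewrite invr_gt0 ltr0n.
have /choice[net netP] : forall n, exists s : seq X,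
    forall x, exists2 y, y \in s & ball y (q n / 2) x.
  by move=> n; apply: finite_net => //; rewrite divr_gt0.
pose U (a : nat * m.-tuple nat) (i : 'I_m) := (ball (nth x0 (net a.1) (tnth a.2 i)) (q a.1))°.
pose sep a := forall i j u v, i != j -> closure (U a i) u -> closure (U a j) v ->
  ~ ball u (q a.1 + q a.1) v.
pose C a := \bigcap_i closure (p @` U a i)°.
have clC a : closed (C a) by apply: closed_bigI => i _; exact: closed_closure.
have mC a : measurable (C a : set (borel_type H)).
  exact: closed_borel.
apply: contrapT => no.
have nuC a : sep a -> nu (C a) = 0%E.
  move=> sa; apply/eqP; rewrite eq_le measure_ge0 andbT leNgt; apply/negP => pos.
  by apply: no; exists (q a.1), (U a); split => // i; exact: open_interior.
(* Candidates are enumerated by their codes; those not separated and numbers coding none contribute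
   the empty set. *)
pose F k : set (borel_type H) := if unpickle k is Some a then
  if `[< sep a >] then C a else set0 else set0.
have mF k : measurable (F k).
  by rewrite /F; case: unpickle => // a; case: ifP.
have nuF k : nu (F k) = 0%E.
  rewrite /F; case: unpickle => [a|]; last exact: measure0.
  by case: asboolP => [/nuC//|_]; exact: measure0.
have cov : (Y : set (borel_type H)) `<=` \bigcup_k F k.
  move=> y Yy; have [c cinj pc] := Yc y Yy.
  have [r r0 rP] := hausdorff_separation hX cinj.
  (* With q the mesh radius, [c i] and [c j] will be joined by steps of q/2, 2q, 2q, 2q and q/2, in
     total 7q. *)
  have r7 : 0 < r / 7 by rewrite divr_gt0.
  have [n _ /(_ n (leqnn n)) /= nr] := near_infty_natSinv_lt (PosNum r7).
  have /choice[t tP] : forall i, exists t, ball (nth x0 (net n) t) (q n / 2) (c i).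
    move=> i; have [z zn zc] := netP n (c i).
    by exists (index z (net n)); rewrite nth_index.
  pose a : nat * m.-tuple nat := (n, [tuple t i | i < m]).
  have Ua i : U a i = (ball (nth x0 (net n) (t i)) (q n))° by rewrite /U /= tnth_mktuple.
  have cU i : U a i (c i).
    rewrite Ua; apply/nbhs_ballP; exists (q n / 2); first by rewrite /= divr_gt0.
    by move=> z cz; rewrite (splitr (q n)); exact: ball_triangle (tP i) cz.
  have clU i u : closure (U a i) u -> ball (nth x0 (net n) (t i)) (q n + q n) u.
    rewrite Ua => /(_ _ (nbhsx_ballx u _ (q0 n)))[z [/interior_subset tz uz]].
    exact: ball_triangle tz (ball_sym uz).
  exists (pickle a) => //; rewrite /F pickleK; case: asboolP => [_|nsep].
    move=> i _; rewrite -(pc i).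
    apply: (image_sub_closure_interior cG cX cH hH actA minX fp).
      exact: open_interior.
    by exists (c i).
  exfalso; apply: nsep => i j u v ij /clU ui /clU vj uv.
  apply: (rP i j ij); have := tP i; have := tP j => tj ti.
  have h1 := ball_triangle (ball_sym ti) (ball_triangle ui uv).
  have h2 := ball_triangle h1 (ball_triangle (ball_sym vj) tj).
  apply: le_ball h2; rewrite /= in nr *; rewrite -/(q n) in nr.
  by clear -nr; lra.
have : (nu Y <= \sum_(0 <= k <oo) nu (F k))%E.
  exact: (measure_sigma_subadditive nu mF mY cov).
rewrite nuY eseries0 => [|k _ _]; last exact: nuF.
by rewrite lee_fin ler10.
Qed.

(** * The ceiling condition and the conclusion *)

Lemma le_ceil_divP (k n K2 : nat) : (k.+2 <= (n + K2 - 1) %/ K2)%N -> (k.+1 * K2 < n)%N.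
Proof.
(* Division by 0 gives 0, so the hypothesis excludes [K2] = 0. *)
have [->|K20] := posnP K2; first by rewrite divn0.
by rewrite leq_divRL // mulSn; lia.
Qed.

Lemma indep_setS (G : group) (X : Type) (act : G -> X -> X) (k : nat)
    (A B : 'I_k -> set X) (J : set G) :
  (forall i, A i `<=` B i) -> indep_set act A J -> indep_set act B J.
Proof.
move=> AB iA I s fI I0 IJ; have [x xP] := iA I s fI I0 IJ.
by exists x => g Ig; apply: AB; exact: xP.
Qed.


Unset Implicit Arguments.

Theorem theorem1p5 (R : realType) (G : group)
  (X : pseudoMetricType R) (H : pseudoPMetricType R) (actX : G -> X -> X) (actH : G -> H -> H)
  (p : X -> H) (nu : probability (borel_type H) R) (K1 : natinf) (K2 : nat) :
  countable [set: G] -> infinite_set [set: G] ->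
  Gsystem actX -> minimal_sys actX ->
  is_MEF actX actH p ->
  (forall (g : G) (A : set (borel_type H)), measurable A ->
     nu (actH g @^-1` A) = nu A) ->
  measurable [set y : borel_type H | card_is (p @^-1` [set y]) K1] ->
  nu [set y : borel_type H | card_is (p @^-1` [set y]) K1] = 1%E ->
  almost_to_one p K2 ->
  forall K : nat, (2 <= K)%N -> le_ceil_div K K1 K2 ->
    exists x : 'I_K -> X, IT_tuple actX x /\ ~ in_diag x.
Proof.
move=> cG _ [cX hX actAX] minX [[cH hH actAH] fp eqH _] nu_inv mY nuY resK2.
case=> [//|[//|k]] _ ceilK.
have [cp psurj pequiv] := fp.
set Y := [set y : borel_type H | card_is (p @^-1` [set y]) K1] in mY nuY.
(* Here K is [k.+2]; [m] is the least number of sets for which the pigeonhole gives one of [K2]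
   points K of them. *)
pose m := (k.+1 * K2).+1.
have Yc y : Y y -> exists2 c : 'I_m -> X, injective c & forall i, p (c i) = y.
  move=> Yy; apply: (card_is_inj Yy).
  by case: (K1) ceilK => // n; exact: le_ceil_divP.
have [r [U [r0 oU sepU nuC]]] :=
  positive_measure_tuple cG cX hX cH hH actAH minX fp mY nuY Yc.
have minH : minimal_sys actH.
  move=> y; apply/seteqP; split => // z _ B Bz.
  have [x px] := psurj y; have [w pw] := psurj z.
  have : closure [set actX g x | g in [set: G]] w by rewrite minX.
  have pB : nbhs w (p @^-1` B) by apply: cp; rewrite pw.
  move=> /(_ _ pB)[_ [[g _ <-] Bg]]; exists (actH g y); split; first by exists g.
  by rewrite -px -pequiv.
have [||g gP] := independent_visits cH actAH minH eqH nu_inv _ _ nuC.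
- by move=> i; exact: open_interior.
- by apply: closed_bigI => i _; exact: closed_closure.
have [ca _ _] := actAH.
have finite_word n (s : nat -> 'I_m) : exists x : 'I_K2 -> X,
    forall j, (j < n)%N -> exists a, U (s j) (actX (g j) (x a)).
  have [h hV] := gP n s.
  (* Finitely many visits are an open condition on [h], and the fibres with [K2] points lie over a
     dense set. *)
  pose O := [set h' | forall j : 'I_n, (p @` U (s j))° (actH (g j) h')].
  have Oh : O° h.
    apply: filter_forall => j; apply: ca; apply: open_nbhs_nbhs.
    by split; [exact: open_interior|exact: hV].
  have [|h' [/interior_subset Oh' /card_is_surj[x xP]]] :=
      residual_dense cH resK2 _ (open_interior O).
    by exists h.
  exists x => j jn; have [u Uu pu] := interior_subset (Oh' (Ordinal jn)).
  (* The point [u] above [actH (g j) h'], pulled back by [g j], lies in the fibre over [h'] and is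
     thus one of the listed points. *)
  have [|a xa] := xP (actX (ginv (g j)) u).
    by rewrite /= pequiv pu act_ginvK.
  by exists a; rewrite xa act_ginvKV.
have [F [FU oF]] := @ultraFilterLemma _ (\oo : set_system nat) _.
have words (s : nat -> 'I_m) : exists x : 'I_K2 -> X,
    forall n, exists a, closure (U (s n)) (actX (g n) (x a)).
  have /choice[xn xnP] := fun n => finite_word n s.
  have /choice[x xP] : forall a, exists l : X, (fun n => xn n a) @ F --> l.
    by move=> a; exact: ultra_cvg.
  exists x => j.
  (* For each time [j] a single index [a] works along the ultrafilter, so the limit point visits the
     closure. *)
  have [a aP] : exists a, \forall n \near F, U (s j) (actX (g j) (xn n a)).
    apply: ultra_exists; apply: oF; exists j.+1 => // n /= jn.
    exact: xnP.
  have [cX' _ _] := actAX; have FP := @ultra_proper _ _ FU.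
  exists a => B /(cX' (g j)) /(xP a) FB.
  have [n [/= Un Bn]] := filter_ex (filterI aP FB).
  by exists (actX (g j) (xn n a)).
apply: (IT_tuple_of_separated cX r0) => e e0.
have e10 : 0 < Num.min e (r / 2) by rewrite lt_min e0 /= divr_gt0.
have e1r : Num.min e (r / 2) + Num.min e (r / 2) <= r.
  by rewrite [leRHS]splitr lerD // ge_min lexx orbT.
have [x [xsep [J [Jinf Jind]]]] :=
  separated_independent cX e10 e1r (ltnSn (k.+1 * K2)) sepU words.
exists x; split => //; exists J; split => //.
apply: indep_setS Jind => i; apply: le_ball.
by rewrite ge_min lexx.
Qed.
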